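(* Let $H$ be a separable complex Hilbert space with orthonormal basis $\{e_n\}_{n=-\infty}^{+\infty}$, let $\{\beta_n\}_{n=-\infty}^{+\infty}$ be a bounded sequence of nonzero complex numbers, and let $T\in B(H)$ be the bilateral weighted shift with $Te_n=\beta_n e_{n+1}$ for all $n\in\mathbb{Z}$. Suppose $T$ is hyponormal. If there exists an integer $j_0$ such that $|\beta_{j_0-1}|<|\beta_{j_0}|=|\beta_{j_0+1}|<|\beta_{j_0+2}|$, then $T$ is not near subnormal.
   Context: $B(H)$ is the algebra of all bounded linear operators on $H$. For $A\in B(H)$ put $Q_A=A^*A-AA^*$; $A$ is hyponormal if $Q_A\ge 0$. For $A,D\in B(H)$ with $D\ge 0$, $A$ is called $D$-near subnormal if there exists a constant $m>0$ such that $D\ge mA^*DA$. A hyponormal operator $A$ is called near subnormal if it is $Q_A$-near subnormal, i.e. if there exists a constant $m>0$ such that $Q_A\ge mA^*Q_AA$. *)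

(* Defs.v *)
From HB Require Import structures.
From mathcomp Require Import all_boot all_order all_algebra.
From mathcomp Require Import all_classical all_reals all_analysis.

Set Implicit Arguments.
Unset Strict Implicit.
Unset Printing Implicit Defensive.

Import Order.TTheory GRing.Theory Num.Theory.
Import numFieldNormedType.Exports.

Local Open Scope classical_set_scope.
Local Open Scope ring_scope.

(* The scalar field is meant to be R[i] for R : realType.  The inner product is
   linear in its first argument and conjugate-linear in the second, and induces
   the norm of the underlying Banach space.  The order on scalars is the partial
   one: 0 <= z means that z is real and nonnegative. *)
HB.mixin Record CompleteNormedModule_isHilbert (C : numClosedFieldType)
    (H : Type) of CompleteNormedModule C H := {
  inner : {dot H for @Num.conj C} ;
  inner_norm : forall x : H, `|x| ^+ 2 = inner x x
}.

#[short(type="hilbertType")]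
HB.structure Definition Hilbert (C : numClosedFieldType) :=
  {H of CompleteNormedModule C H & CompleteNormedModule_isHilbert C H}.

Notation "''[' x , y ]" := (inner x y) : ring_scope.

Definition separable_space (X : topologicalType) :=
  exists2 S : set X, countable S & dense S.

Section Hilbert.
Context {C : numClosedFieldType} {H : hilbertType C}.
Implicit Types (A D E : H -> H).

Definition lin_span (I : Type) (e : I -> H) : set H :=
  [set x | exists (s : seq I) (c : I -> C), x = \sum_(i <- s) c i *: e i].

Definition orthonormal_basis (I : eqType) (e : I -> H) :=
  (forall i j, '[e i, e j] = (i == j)%:R) /\ dense (lin_span e).

(* Membership in B(H), for linear A. *)
Definition bounded_operator (A : {linear H -> H}) :=
  exists M : C, forall x, `|A x| <= M * `|x|.

(* For A in B(H), Riesz representation gives exactly one z with the stated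
   property; the value 0 is only a default for other maps. *)
Definition adjoint A : H -> H :=
  fun y => xget 0 [set z | forall x, '[A x, y] = '[x, z]].

(* Since the scalars are complex, this entails that D is self-adjoint. *)
Definition positive_operator D := forall x, 0 <= '[D x, x].

Definition operator_ge D E := positive_operator (fun x => D x - E x).

Definition self_commutator A : H -> H :=
  fun x => adjoint A (A x) - A (adjoint A x).

Definition hyponormal A := positive_operator (self_commutator A).

(* The condition 0 < m forces the scalar m to be real. *)
Definition near_subnormal_wrt D A :=
  positive_operator D /\
  exists2 m : C, 0 < m & operator_ge D (fun x => m *: adjoint A (D (A x))).

Definition near_subnormal A :=
  hyponormal A /\ near_subnormal_wrt (self_commutator A) A.

End Hilbert.

(* Main.v *)
From HB Require Import structures.
Require Import Defs.
From mathcomp Require Import all_boot all_order all_algebra.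
From mathcomp Require Import complex.
From mathcomp Require Import all_classical all_reals all_analysis.

Set Implicit Arguments.
Unset Strict Implicit.
Unset Printing Implicit Defensive.

Import Order.TTheory GRing.Theory Num.Theory.
Import numFieldNormedType.Exports.

Local Open Scope classical_set_scope.
Local Open Scope ring_scope.
Local Open Scope complex_scope.

(** The self-commutator of a bilateral weighted shift is diagonal in the basis
    [e]: since [T e_n = beta_n e_(n+1)] and [T* e_(n+1) = conj(beta_n) e_n], one
    has [Q_T e_n = d_n e_n] with [d_n = |beta_n|^2 - |beta_(n-1)|^2]
    ([self_commutator_shift]), and then [T* Q_T T e_n = |beta_n|^2 d_(n+1) e_n].
    Testing [Q_T >= m T* Q_T T] on [e_n] gives the inequality between weights
    [m |beta_n|^2 d_(n+1) <= d_n] ([near_subnormal_shift_weights]): once [d_n]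
    vanishes, [d_(n+1)] cannot be positive.  A plateau
    [|beta_j0| = |beta_(j0+1)| < |beta_(j0+2)|] violates it at [n = j0 + 1].

    The analytic part is the formula for [T*] on basis vectors
    ([adjoint_shift]).  As [adjoint] is defined by choice from the vectors that
    represent a functional, that formula requires uniqueness of the
    representing vector ([adjoint_eq]) and the identity
    [<T x, e_(n+1)> = beta_n <x, e_n>] for every [x]; the latter is clear when
    [x] is a basis vector and extends to [H] because both sides are bounded
    linear functionals of [x] and the span of [e] is dense
    ([bounded_functional_eq0]). *)

Section InnerProduct.
Context {C : numClosedFieldType} {H : hilbertType C}.

(** Bessel's inequality for a single unit vector: subtracting from [x] its
    projection [a u] leaves a vector of squared norm [|x|^2 - |a|^2]. *)
Lemma norm_inner_unit (x u : H) : '[u, u] = 1 -> `|'[x, u]| <= `|x|.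
Proof.
move=> u1; rewrite -(@ler_pXn2r _ 2) ?nnegrE // inner_norm.
set a := '[x, u].
have := dnorm_ge0 (@inner C H) (x - a *: u).
rewrite dnormB dnormZ u1 mulr1 linearZr_LR /= -/a.
have -> : a^* * a = `|a| ^+ 2 by rewrite mulrC -normCK.
by rewrite rmorphXn /= conj_normC opprD addrA addrK subr_ge0.
Qed.

(** If [f x] were nonzero, a point of the span closer to [x] than [|f x| / M]
    would have a nonzero image as well. *)
Lemma bounded_functional_eq0 (I : Type) (e : I -> H) (f : {scalar H}) (M : C) :
    dense (lin_span e) -> (forall x, `|f x| <= M * `|x|) ->
    (forall i, f (e i) = 0) ->
  forall x, f x = 0.
Proof.
move=> e_dense f_bdd fe0 x; apply/eqP/negPn/negP => fx_neq0.
have fx_gt0 : 0 < `|f x| by rewrite normr_gt0.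
have x_gt0 : 0 < `|x|.
  by rewrite normr_gt0; apply: contra_neq fx_neq0 => ->; rewrite linear0.
have M_gt0 : 0 < M by rewrite -(pmulr_lgt0 _ x_gt0) (lt_le_trans fx_gt0).
have r_gt0 : 0 < `|f x| / M by rewrite divr_gt0.
(* Within this radius, the bound on f keeps |f (x - y)| below |f x|. *)
have [||y [xy [s [c y_def]]]] := e_dense (ball x (`|f x| / M)).
- by exists x; exact: ballxx.
- exact: ball_open.
have fy0 : f y = 0.
  by rewrite y_def linear_sum big1 // => i _; rewrite linearZ /= fe0 mulr0.
move: xy; rewrite -ball_normE /ball_ /= ltr_pdivlMr // mulrC => xy.
by have := f_bdd (x - y); rewrite linearB fy0 subr0 => /(lt_le_trans xy); rewrite ltxx.
Qed.

(** Definiteness of the inner product leaves at most one vector for [adjoint]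
    to choose, so the values of [adjoint] can be computed by exhibiting them. *)
Lemma adjoint_eq (A : H -> H) (y z : H) :
  (forall x, '[A x, y] = '[x, z]) -> adjoint A y = z.
Proof.
move=> Ayz; apply: xget_unique => //= z' Ayz'.
apply/eqP; rewrite -subr_eq0 -(dnorm_eq0 (@inner C H)).
by rewrite linearBr /= -Ayz -Ayz' subrr.
Qed.

End InnerProduct.

Section BilateralShift.
Context {C : numClosedFieldType} {H : hilbertType C}.
Variables (e : int -> H) (beta : int -> C) (T : {linear H -> H}).
Hypothesis e_basis : orthonormal_basis e.
Hypothesis T_bounded : bounded_operator T.
Hypothesis T_shift : forall n : int, T (e n) = beta n *: e (n + 1).

Let e_unit n : '[e n, e n] = 1.
Proof. by rewrite e_basis.1 eqxx. Qed.

Lemma inner_shift (n : int) (x : H) : '[T x, e (n + 1)] = beta n * '[x, e n].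
Proof.
pose f x := '[T x, e (n + 1)] - beta n * '[x, e n].
have f_lin : scalar f.
  move=> a u v; rewrite /f linearP !linearPl /=.
  by rewrite mulrDr mulrCA mulrBr opprD addrACA.
pose f_isLinear := GRing.isLinear.Build _ _ _ _ f f_lin.
pose F : {scalar H} := HB.pack f f_isLinear.
have [M T_bdd] := T_bounded.
apply/eqP; rewrite -subr_eq0; apply/eqP.
apply: (bounded_functional_eq0 (f := F) (M := M + `|beta n|) e_basis.2).
  move=> y; rewrite /= /f (le_trans (ler_normB _ _))// mulrDl lerD //.
    exact: le_trans (norm_inner_unit _ (e_unit _)) (T_bdd y).
  by rewrite normrM ler_wpM2l // norm_inner_unit.
move=> i; rewrite /= /f T_shift linearZl_LR /= !e_basis.1.
rewrite (inj_eq (addIr _)); case: eqVneq => [->|_]; first by rewrite subrr.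
by rewrite !mulr0 subrr.
Qed.

Lemma adjoint_shift (c : C) (n : int) :
  adjoint T (c *: e (n + 1)) = (c * (beta n)^* ) *: e n.
Proof.
apply: adjoint_eq => x.
by rewrite !linearZr_LR /= inner_shift rmorphM /= conjCK mulrA.
Qed.

(** The scalar [c] is carried along because [adjoint] is not known to be
    linear here, while this formula is applied both to [e n] and to
    [T (e n)], a multiple of the next basis vector. *)
Lemma self_commutator_shift (c : C) (n : int) :
  self_commutator T (c *: e n)
    = (c * (`|beta n| ^+ 2 - `|beta (n - 1)| ^+ 2)) *: e n.
Proof.
rewrite /self_commutator linearZ /= T_shift scalerA adjoint_shift.
have -> : adjoint T (c *: e n) = (c * (beta (n - 1))^* ) *: e (n - 1).
  by rewrite -{1}[n](subrK 1) adjoint_shift.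
rewrite linearZ /= T_shift subrK scalerA -scalerBl.
by rewrite !normCK mulrBr -!mulrA [_^* * beta (n - 1)]mulrC.
Qed.

Lemma near_subnormal_shift_weights :
    near_subnormal_wrt (self_commutator T) T ->
  exists2 m : C, 0 < m & forall n : int,
    m * `|beta n| ^+ 2 * (`|beta (n + 1)| ^+ 2 - `|beta n| ^+ 2)
      <= `|beta n| ^+ 2 - `|beta (n - 1)| ^+ 2.
Proof.
case=> _ [m m_gt0 Q_ge]; exists m => // n; have := Q_ge (e n).
rewrite T_shift self_commutator_shift adjoint_shift addrK.
rewrite -{1}[e n]scale1r self_commutator_shift mul1r scalerA -scalerBl.
rewrite linearZl_LR /= e_unit mulr1 subr_ge0.
by rewrite [beta n * _ * _]mulrAC -normCK mulrA.
Qed.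

End BilateralShift.

Theorem theorem4 (R : realType) (H : hilbertType R[i]) (e : int -> H)
    (beta : int -> R[i]) (T : {linear H -> H}) :
  separable_space H ->
  orthonormal_basis e ->
  (exists M : R[i], forall n : int, `|beta n| <= M) ->
  (forall n : int, beta n != 0) ->
  bounded_operator T ->
  (forall n : int, T (e n) = beta n *: e (n + 1)) ->
  hyponormal T ->
  (exists j0 : int,
     [/\ `|beta (j0 - 1)| < `|beta j0|,
         `|beta j0| = `|beta (j0 + 1)| &
         `|beta (j0 + 1)| < `|beta (j0 + 2)|]) ->
  ~ near_subnormal T.
Proof.
move=> _ e_basis _ beta_neq0 T_bounded T_shift _ [j [_ plateau jump]] [_ T_near].
have [m m_gt0 /(_ (j + 1))] :=
  near_subnormal_shift_weights e_basis T_bounded T_shift T_near.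
rewrite addrK -[j + 1 + 1]addrA -{3}plateau subrr.
suff pos : 0 < m * `|beta (j + 1)| ^+ 2
               * (`|beta (j + 2)| ^+ 2 - `|beta (j + 1)| ^+ 2).
  by move/(lt_le_trans pos); rewrite ltxx.
by rewrite !mulr_gt0 ?exprn_gt0 ?normr_gt0 // subr_gt0 ltr_pXn2r ?nnegrE.
Qed.
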